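(* Let $\mathcal{C}$ be a small preadditive category with set of objects $\mathcal{C}_0$ and let $\mathcal{G}:=\mathcal{C}_0\times\mathcal{C}_0$. The following statements hold true. (1) For each $A\in\mathcal{C}_0$, $\mathcal{C}(-,A)$ is an artinian object of $\mathrm{Fun}(\mathcal{C}^{op},\mathcal{A}b)$ if and only if $R[\mathcal{C}](\varepsilon_A)$ is a gr-artinian $\mathcal{G}$-graded $R[\mathcal{C}]$-module. (2) $\mathcal{C}$ is a right artinian category if and only if $R[\mathcal{C}]$ is a right $\mathcal{G}_0$-artinian ring. (3) $\mathcal{C}$ is a simple category if and only if $R[\mathcal{C}]$ is a gr-simple $\mathcal{G}$-graded ring.
   Context: A small preadditive category $\mathcal{C}$ has a set of objects $\mathcal{C}_0$ and abelian groups $\mathcal{C}(A,B)$ of morphisms $A\to B$ with $\mathbb{Z}$-bilinear composition; $\mathcal{A}b$ is the category of abelian groups; $\mathrm{Fun}(\mathcal{C}^{op},\mathcal{A}b)$ is the category of additive contravariant functors $\mathcal{C}\to\mathcal{A}b$; $\mathcal{C}(-,A)$ is the representable functor. An object is artinian if its subobjects satisfy the descending chain condition. $\mathcal{C}$ is a right artinian category if $\mathcal{C}(-,A)$ is an artinian object of $\mathrm{Fun}(\mathcal{C}^{op},\mathcal{A}b)$ for each $A\in\mathcal{C}_0$. An ideal of $\mathcal{C}$ is an additive subfunctor of the bifunctor $\mathcal{C}(-,-):\mathcal{C}^{op}\times\mathcal{C}\to\mathcal{A}b$. $\mathcal{C}$ is a simple category if the only nonzero ideal of $\mathcal{C}$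 is $\mathcal{C}(-,-)$ (in particular $\mathcal{C}(-,-)$ is nonzero). $\mathcal{G}=\mathcal{C}_0\times\mathcal{C}_0$ is the groupoid with $r(Y,X)=Y$, $d(Y,X)=X$, $(Z,Y)(Y,X)=(Z,X)$ and idempotents $\varepsilon_A=(A,A)$, forming $\mathcal{G}_0$. $R[\mathcal{C}]=\bigoplus_{A,B}\mathcal{C}(A,B)$ is the ring with product $fg=f\circ g$ when the composition makes sense and $0$ otherwise; it is $\mathcal{G}$-graded by $R[\mathcal{C}]_{(A,B)}=\mathcal{C}(B,A)$. $R[\mathcal{C}](\varepsilon_A)=\bigoplus_{X\in\mathcal{C}_0}R[\mathcal{C}]_{(A,X)}$, a graded right ideal. Graded submodules/ideals are those that are sums of their intersections with the homogeneous components. A graded module is gr-artinian if its graded submodules satisfy the descending chain condition. $R[\mathcal{C}]$ is right $\mathcal{G}_0$-artinian if $R[\mathcal{C}](\varepsilon_A)$ is a gr-artinian right $R[\mathcal{C}]$-module for all $A\in\mathcal{C}_0$. $R[\mathcal{C}]$ is gr-simple if it is nonzero and its only graded two-sided ideals are $0$ and $R[\mathcal{C}]$. *)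

(* Defs.v *)
From HB Require Import structures.
From mathcomp Require Import all_boot all_order all_algebra.
From mathcomp Require Import all_classical.

Set Implicit Arguments.
Unset Strict Implicit.
Unset Printing Implicit Defensive.

Import GRing.Theory.
Local Open Scope classical_set_scope.
Local Open Scope ring_scope.

(* [comp g f] is the composite g o f. The objects form a [choiceType] so that
   they can index sums; with the axioms of [boolp] every type is one. *)
Record preadditive := Preadditive {
  obj :> choiceType;
  hom : obj -> obj -> zmodType;
  idm : forall A : obj, hom A A;
  comp : forall A B D : obj, hom B D -> hom A B -> hom A D;
  comp1m : forall (A B : obj) (f : hom A B), comp (idm B) f = f;
  compm1 : forall (A B : obj) (f : hom A B), comp f (idm A) = f;
  compA : forall (A B D E : obj) (h : hom D E) (g : hom B D) (f : hom A B),
    comp h (comp g f) = comp (comp h g) f;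
  compDl : forall (A B D : obj) (g g' : hom B D) (f : hom A B),
    comp (g + g') f = comp g f + comp g' f;
  compDr : forall (A B D : obj) (g : hom B D) (f f' : hom A B),
    comp g (f + f') = comp g f + comp g f' }.

Arguments hom {_} _ _.
Arguments idm {_} _.
Arguments comp {_ _ _ _} _ _.

(** * The category Fun(C^op, Ab) *)

Record cofunctor (C : preadditive) := Cofunctor {
  fobj :> C -> zmodType;
  fmap : forall A B : C, hom A B -> {additive fobj B -> fobj A};
  fmap1 : forall (A : C) (x : fobj A), fmap (idm A) x = x;
  fmapM : forall (A B D : C) (g : hom B D) (f : hom A B) (x : fobj D),
    fmap (comp g f) x = fmap f (fmap g x);
  fmapD : forall (A B : C) (f f' : hom A B) (x : fobj B),
    fmap (f + f') x = fmap f x + fmap f' x }.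

Arguments fmap {_} _ {_ _} _.

Record nattrans (C : preadditive) (F G : cofunctor C) := Nattrans {
  ncomp :> forall A : C, {additive F A -> G A};
  natural : forall (A B : C) (f : hom A B) (x : F B),
    ncomp A (fmap F f x) = fmap G f (ncomp B x) }.

Lemma nattrans_ext (C : preadditive) (F G : cofunctor C) (a b : nattrans F G) :
  (forall A (x : F A), a A x = b A x) -> a = b.
Proof.
case: a b => [a an] [b bn] /= ab.
have E : a = b.
  apply: functional_extensionality_dep => A.
  move: (ab A); case: (a A) => f [[cf]]; case: (b A) => g [[cg]] /= fg.
  have {fg}efg : f = g by apply/funext.
  by subst g; rewrite (Prop_irrelevance cf cg).
by subst b; congr Nattrans; apply: Prop_irrelevance.
Qed.

Section NatComp.
Variables (C : preadditive) (F G H : cofunctor C).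
Variables (b : nattrans G H) (a : nattrans F G).

Let c (A : C) : {additive F A -> H A} := (b A \o a A).

Lemma nat_comp_natural (A B : C) (f : hom A B) (x : F B) :
  c A (fmap F f x) = fmap H f (c B x).
Proof. by rewrite /c /= !natural. Qed.

Definition nat_comp : nattrans F H := Nattrans nat_comp_natural.
End NatComp.

Definition monic (C : preadditive) (F G : cofunctor C) (i : nattrans F G) :=
  forall (H : cofunctor C) (a b : nattrans H F),
    nat_comp i a = nat_comp i b -> a = b.

(* A subobject is represented by a monomorphism; two of them represent the same
   subobject when each factors through the other. *)
Record subobj (C : preadditive) (F : cofunctor C) := Subobj {
  sub_dom : cofunctor C;
  sub_mor :> nattrans sub_dom F;
  sub_monic : monic sub_mor }.

Definition sub_le (C : preadditive) (F : cofunctor C) (i j : subobj F) : Prop :=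
  exists k : nattrans (sub_dom i) (sub_dom j), sub_mor i = nat_comp (sub_mor j) k.

Definition artinian_object (C : preadditive) (F : cofunctor C) : Prop :=
  forall S : nat -> subobj F, (forall n, sub_le (S n.+1) (S n)) ->
    exists m, forall n, (m <= n)%N -> sub_le (S n) (S m) /\ sub_le (S m) (S n).

Section Representable.
Variables (C : preadditive) (A : C).

Definition precomp (X Y : C) (f : hom X Y) (g : hom Y A) : hom X A := comp g f.

Lemma precomp_is_nmod_morphism (X Y : C) (f : hom X Y) :
  nmod_morphism (precomp f).
Proof.
split; last by move=> g g'; exact: compDl.
by apply: (addrI (precomp f 0)); rewrite /precomp -compDl !addr0.
Qed.

HB.instance Definition _ (X Y : C) (f : hom X Y) :=
  GRing.isNmodMorphism.Build (hom Y A) (hom X A) (precomp f)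
    (precomp_is_nmod_morphism f).

Definition representable : cofunctor C :=
  @Cofunctor C (fun X => hom X A)
    (fun X Y f => precomp f : {additive hom Y A -> hom X A})
    (fun X g => compm1 g) (fun X Y Z g f x => compA x g f)
    (fun X Y f f' x => compDr x f f').
End Representable.

Definition right_artinian_category (C : preadditive) : Prop :=
  forall A : C, artinian_object (representable A).

Record cat_ideal (C : preadditive) (I : forall A B : C, set (hom A B)) : Prop :=
  CatIdeal {
    cat_ideal0 : forall A B : C, I A B 0;
    cat_idealB : forall (A B : C) (f g : hom A B),
      I A B f -> I A B g -> I A B (f - g);
    cat_ideall : forall (A B D : C) (g : hom B D) (f : hom A B),
      I A B f -> I A D (comp g f);
    cat_idealr : forall (A B D : C) (g : hom B D) (f : hom A B),
      I B D g -> I A D (comp g f) }.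

Definition simple_category (C : preadditive) : Prop :=
  (exists (A B : C) (f : hom A B), f <> 0) /\
  forall I : forall A B : C, set (hom A B), cat_ideal I ->
    (exists (A B : C) (f : hom A B), I A B f /\ f <> 0) ->
    forall (A B : C) (f : hom A B), I A B f.

(** * The ring R[C], graded by the groupoid C_0 x C_0 *)

(* [x A B] is the component of x in R[C]_(A,B) = C(B,A). *)
Record catring (C : preadditive) := Catring {
  coef :> forall A B : C, hom B A;
  coef_fin : finite_set [set p : C * C | coef p.1 p.2 <> 0] }.

HB.instance Definition _ (C : preadditive) := gen_eqMixin (catring C).
HB.instance Definition _ (C : preadditive) := gen_choiceMixin (catring C).

Section CatringZmodule.
Variable C : preadditive.
Implicit Types x y z : catring C.

Lemma catringP x y : (forall A B, x A B = y A B) -> x = y.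
Proof.
case: x y => [x xf] [y yf] /= xy.
have e : x = y by do 2!apply: functional_extensionality_dep => ?.
by subst y; congr Catring; exact: Prop_irrelevance.
Qed.

Lemma cr0_fin : finite_set [set p : C * C | (0 : hom p.2 p.1) <> 0].
Proof. by apply: (sub_finite_set _ (finite_set0 _)) => p /=; apply. Qed.
Definition cr0 : catring C := @Catring C (fun A B => 0) cr0_fin.

Lemma crN_fin x : finite_set [set p : C * C | - x p.1 p.2 <> 0].
Proof.
by apply: sub_finite_set (coef_fin x) => p /= + e; rewrite e oppr0; apply.
Qed.
Definition crN x : catring C := @Catring C (fun A B => - x A B) (crN_fin x).

Lemma crD_fin x y : finite_set [set p : C * C | x p.1 p.2 + y p.1 p.2 <> 0].
Proof.
have := conj (coef_fin x) (coef_fin y); rewrite -finite_setU; apply: sub_finite_set.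
move=> p /= h; have [e|] := pselect (x p.1 p.2 = 0); last by left.
by right=> e'; apply: h; rewrite e e' addr0.
Qed.
Definition crD x y : catring C :=
  @Catring C (fun A B => x A B + y A B) (crD_fin x y).

Lemma crDA : associative crD.
Proof. by move=> x y z; apply: catringP => A B /=; rewrite addrA. Qed.
Lemma crDC : commutative crD.
Proof. by move=> x y; apply: catringP => A B /=; rewrite addrC. Qed.
Lemma cr0D : left_id cr0 crD.
Proof. by move=> x; apply: catringP => A B /=; rewrite add0r. Qed.
Lemma crND : left_inverse cr0 crN crD.
Proof. by move=> x; apply: catringP => A B /=; rewrite addNr. Qed.

HB.instance Definition _ := GRing.isZmodule.Build (catring C) crDA crDC cr0D crND.
End CatringZmodule.

Section CatringMul.
Variable C : preadditive.
Implicit Types (x y z : catring C) (A B D X : C).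

Lemma comp0m A B D (f : hom A B) : comp (0 : hom B D) f = 0.
Proof. by apply: (addrI (comp 0 f)); rewrite -compDl !addr0. Qed.

Lemma compm0 A B D (g : hom B D) : comp g (0 : hom A B) = 0.
Proof. by apply: (addrI (comp g 0)); rewrite -compDr !addr0. Qed.

Definition crM_coef x y A B : hom B A := \sum_(X \in [set: C]) comp (x A X) (y X B).

Lemma crM_coefE x y A B (s : seq C) : uniq s ->
  (forall X, X \notin s -> comp (x A X) (y X B) = 0) ->
  crM_coef x y A B = \sum_(X <- s) comp (x A X) (y X B).
Proof.
move=> us s0; rewrite /crM_coef (fsbigE s) // => [|X _]; last exact: s0.
by apply: eq_bigl => X; rewrite in_setT.
Qed.

Lemma crM_fin x y : finite_set [set p : C * C | crM_coef x y p.1 p.2 <> 0].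
Proof.
have := finite_setX (coef_fin x) (coef_fin y).
move=> /(finite_image (fun q : (C * C) * (C * C) => (q.1.1, q.2.2))).
apply: sub_finite_set => -[A B] /= h; apply: contrapT => nh; apply: h.
apply: fsbig1 => X _.
have [->|x0] := pselect (x A X = 0); first by rewrite comp0m.
have [->|y0] := pselect (y X B = 0); first by rewrite compm0.
by exfalso; apply: nh; exists ((A, X), (X, B)).
Qed.

(* R[C] has no unit element in general. *)
Definition crM x y : catring C := @Catring C (crM_coef x y) (crM_fin x y).

(* A list containing every object involved in x. *)
Lemma coef_seq x : exists2 s : seq C, uniq s &
  forall A B, x A B <> 0 -> (A \in s) && (B \in s).
Proof.
have /finite_seqP[t ht] := coef_fin x.
exists (undup (map fst t ++ map snd t)); first exact: undup_uniq.
move=> A B h; have : [set` t] (A, B) by rewrite -ht.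
move=> /= abt; rewrite !mem_undup !mem_cat (map_f fst abt) /=.
by rewrite (map_f snd abt) orbT.
Qed.

Lemma crM_seq x y z : exists2 s : seq C, uniq s &
  forall A B, A \notin s \/ B \notin s ->
    [/\ x A B = 0, y A B = 0 & z A B = 0].
Proof.
have [sx _ hx] := coef_seq x; have [sy _ hy] := coef_seq y.
have [sz _ hz] := coef_seq z.
exists (undup (sx ++ sy ++ sz)); first exact: undup_uniq.
move=> A B; rewrite !mem_undup !mem_cat !negb_or => h.
split; apply: contrapT; [move/hx|move/hy|move/hz] => /andP[hA hB];
  by move: h; rewrite hA hB /= ?andbF; case.
Qed.

Lemma crMA : associative crM.
Proof.
move=> x y z; have [s us h] := crM_seq x y z.
have h1 (u : catring C) (A B : C) :
    u = x \/ u = y \/ u = z -> A \notin s \/ B \notin s -> u A B = 0.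
  by move=> hu /h[? ? ?]; case: hu => [->|[->|->]].
apply: catringP => A B /=.
rewrite (crM_coefE us); last first.
  by move=> X Xs; rewrite h1 ?comp0m; tauto.
rewrite (crM_coefE us); last first.
  by move=> X Xs; rewrite (h1 z) ?compm0; tauto.
transitivity (\sum_(X <- s) \sum_(Y <- s) comp (x A X) (comp (y X Y) (z Y B))).
  apply: eq_bigr => X _ /=; rewrite (crM_coefE us); last first.
    by move=> Y Ys; rewrite (h1 y) ?comp0m; tauto.
  exact: (big_morph (comp (x A X)) (fun f g => compDr (x A X) f g)
           (@compm0 _ _ _ (x A X))).
rewrite exchange_big; apply: eq_bigr => Y _ /=.
rewrite (crM_coefE us); last first.
  by move=> X Xs; rewrite (h1 x) ?comp0m; tauto.
rewrite (big_morph (fun f => comp f (z Y B))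
  (fun f g => compDl f g (z Y B)) (@comp0m _ _ _ (z Y B))).
by apply: eq_bigr => X _; rewrite compA.
Qed.

Lemma crMDl : left_distributive crM (+%R : catring C -> _).
Proof.
move=> x y z; have [s us h] := crM_seq x y z; apply: catringP => A B /=.
have h1 X : X \notin s -> z X B = 0.
  by move=> Xs; have [_ _ ->] := h X B (or_introl Xs).
rewrite (crM_coefE us) => [|X /h1 ->]; last exact: compm0.
rewrite (crM_coefE (x := x) us) => [|X /h1 ->]; last exact: compm0.
rewrite (crM_coefE (x := y) us) => [|X /h1 ->]; last exact: compm0.
by rewrite -big_split; apply: eq_bigr => X _; rewrite /= compDl.
Qed.

Lemma crMDr : right_distributive crM (+%R : catring C -> _).
Proof.
move=> x y z; have [s us h] := crM_seq x y z; apply: catringP => A B /=.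
have h1 X : X \notin s -> x A X = 0.
  by move=> Xs; have [-> _ _] := h A X (or_intror Xs).
rewrite (crM_coefE us) => [|X /h1 ->]; last exact: comp0m.
rewrite (crM_coefE (y := y) us) => [|X /h1 ->]; last exact: comp0m.
rewrite (crM_coefE (y := z) us) => [|X /h1 ->]; last exact: comp0m.
by rewrite -big_split; apply: eq_bigr => X _; rewrite /= compDr.
Qed.
End CatringMul.

(* In the groupoid C_0 x C_0, the idempotent (A,A) is identified with A; the
   arrow g has range g.1 and domain g.2. *)
Definition homog (C : preadditive) (g : C * C) : set (catring C) :=
  [set x | forall A B : C, (A, B) <> g -> x A B = 0].

(* The additive submonoid generated by S, so the sum of the subgroups N i when
   S is their union. *)
Definition sums (C : preadditive) (S : set (catring C)) : set (catring C) :=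
  [set x | exists2 s : seq (catring C),
     (forall y, y \in s -> S y) & x = \sum_(y <- s) y].

Section Grading.
Variable C : preadditive.
Implicit Types (x y : catring C) (A B D : C).

Section Inj.
Variables (A B : C) (f : hom B A).

Definition cr_in_coef (A' B' : C) : hom B' A' :=
  match pselect (A = A'), pselect (B = B') with
  | left eA, left eB =>
      ecast X (hom X A') eB (ecast Y (hom B Y) eA f)
  | _, _ => 0
  end.

Lemma cr_in_id : cr_in_coef A B = f.
Proof.
rewrite /cr_in_coef; case: pselect => // eA; case: pselect => // eB.
by rewrite (eq_irrelevance eA erefl) (eq_irrelevance eB erefl).
Qed.

Lemma cr_in_ne (A' B' : C) : (A', B') <> (A, B) -> cr_in_coef A' B' = 0.
Proof.
rewrite /cr_in_coef; case: pselect => // eA; case: pselect => // eB.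
by subst A' B'.
Qed.

Lemma cr_in_fin : finite_set [set p : C * C | cr_in_coef p.1 p.2 <> 0].
Proof.
apply: sub_finite_set (finite_set1 (A, B)) => -[A' B'] /= h.
by apply: contrapT => /cr_in_ne.
Qed.

(* The embedding of C(B,A) in R[C] as the component of degree (A,B). *)
Definition cr_in : catring C := @Catring C cr_in_coef cr_in_fin.
End Inj.

Lemma homogE A B : homog (A, B) = range (@cr_in A B).
Proof.
apply/seteqP; split => [x hx|_ [f _ <-] A' B' /=]; last exact: cr_in_ne.
exists (x A B) => //; apply: catringP => A' B' /=.
have [[-> ->]|ne] := pselect ((A', B') = (A, B)); first by rewrite cr_in_id.
by rewrite cr_in_ne // hx.
Qed.

Lemma cr_inM A B D (f : hom B A) (g : hom D B) :
  crM (cr_in f) (cr_in g) = cr_in (comp f g).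
Proof.
apply: catringP => A' D' /=.
rewrite (@crM_coefE _ _ _ _ _ [:: B]) //; last first.
  by move=> X; rewrite inE => /eqP XB; rewrite /= cr_in_ne ?comp0m // => -[].
rewrite big_seq1 /=.
have [[-> ->]|ne] := pselect ((A', D') = (A, D)); first by rewrite !cr_in_id.
rewrite [RHS]cr_in_ne //; have [eA|nA] := pselect (A' = A).
  by rewrite (@cr_in_ne _ _ g) ?compm0 // => -[eD]; apply: ne; rewrite eA eD.
by rewrite cr_in_ne ?comp0m // => -[].
Qed.

Lemma cr_inM0 A B B' D (f : hom B A) (g : hom D B') : B <> B' ->
  crM (cr_in f) (cr_in g) = 0.
Proof.
move=> nB; apply: catringP => A' D' /=; apply: fsbig1 => X _.
have [XB|nX] := pselect (X = B).
  by rewrite /= (@cr_in_ne _ _ g) ?compm0 // => -[XB' _]; apply: nB; rewrite -XB.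
by rewrite /= cr_in_ne ?comp0m // => -[].
Qed.

Lemma catring_decomp x : exists2 t : seq (C * C),
  (forall p, p \in t -> x p.1 p.2 <> 0) & x = \sum_(p <- t) cr_in (x p.1 p.2).
Proof.
have /finite_seqP[t ht] := coef_fin x.
have tP p : p \in undup t <-> x p.1 p.2 <> 0.
  by rewrite mem_undup; split=> h; [have : [set` t] p by []; rewrite -ht
    | have : [set` t] p by rewrite -ht].
exists (undup t); first by move=> p /tP.
apply: catringP => A B.
rewrite (big_morph (fun y : catring C => y A B) (id1 := 0) (op1 := +%R)) //=.
have [abt|nabt] := boolP ((A, B) \in undup t).
  rewrite (bigD1_seq (A, B)) ?undup_uniq //= cr_in_id big1 ?addr0 // => p /eqP np.
  by rewrite /= cr_in_ne // -surjective_pairing => e; apply: np.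
rewrite big1_seq => [|p /andP[_ pt]].
  by apply: contrapT => h; move/negP: nabt; apply; apply/tP.
by rewrite /= cr_in_ne // -surjective_pairing => e; move: nabt; rewrite e pt.
Qed.
End Grading.

(* R[C](eps_A), the sum of the components whose degree has range A. *)
Definition cr_eps (C : preadditive) (A : C) : set (catring C) :=
  sums (\bigcup_(X in [set: C]) homog (A, X)).

Record subgroup (C : preadditive) (N : set (catring C)) : Prop := Subgroup {
  subgroup0 : N 0;
  subgroupB : forall x y, N x -> N y -> N (x - y) }.

Record right_submodule (C : preadditive) (N : set (catring C)) : Prop :=
  RightSubmodule {
    right_submodule_subgroup : subgroup N;
    right_submoduleM : forall x a, N x -> N (crM x a) }.

Record two_sided_ideal (C : preadditive) (N : set (catring C)) : Prop :=
  TwoSidedIdeal {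
    two_sided_ideal_subgroup : subgroup N;
    two_sided_idealMr : forall x a, N x -> N (crM x a);
    two_sided_idealMl : forall x a, N x -> N (crM a x) }.

Definition graded (C : preadditive) (N : set (catring C)) : Prop :=
  N = sums (\bigcup_(g in [set: C * C]) (N `&` homog g)).

Section Eps.
Variables (C : preadditive) (A : C).

Lemma cr_epsP (x : catring C) :
  cr_eps A x <-> forall B X : C, B <> A -> x B X = 0.
Proof.
split=> [[s hs ->] B X nBA|h].
  rewrite (big_morph (fun y : catring C => y B X) (id1 := 0) (op1 := +%R)) //=.
  by rewrite big1_seq // => y /andP[_ /hs[Z _ hy]]; apply: hy => -[].
have [t ht e] := catring_decomp x.
exists [seq cr_in (x p.1 p.2) | p <- t]; last by rewrite big_map.
move=> _ /mapP[[B X] /ht /= xBX ->].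
have eB : B = A by apply: contrapT => /h hB; apply: xBX; exact: hB.
by subst B; exists X => //; rewrite homogE; exists (x A X).
Qed.

Lemma cr_eps_right_submodule : right_submodule (cr_eps A).
Proof.
split; [split|] => [|x y /cr_epsP hx /cr_epsP hy|x a /cr_epsP hx];
  apply/cr_epsP => B X nBA //=.
  by rewrite hx // hy // subr0.
by apply: fsbig1 => Y _; rewrite hx // comp0m.
Qed.

Lemma cr_eps_graded : graded (cr_eps A).
Proof.
apply/seteqP; split=> [x [s hs ->]|x [s hs ->]].
  exists s => // y /hs[X _ hy]; exists (A, X) => //; split=> //.
  by exists [:: y]; [move=> z; rewrite inE => /eqP->; exists X|rewrite big_seq1].
have [[h0 hB] _] := cr_eps_right_submodule.
rewrite big_seq; apply: (big_ind (cr_eps A)) => // [y z hy hz|y /hs[g _ []] //].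
by rewrite -[z]opprK; apply: (hB) => //; rewrite -sub0r; exact: hB.
Qed.
End Eps.

(* For a graded right submodule M of R[C]. *)
Definition gr_artinian (C : preadditive) (M : set (catring C)) : Prop :=
  forall N : nat -> set (catring C),
    (forall n, right_submodule (N n) /\ graded (N n) /\ N n `<=` M) ->
    (forall n, N n.+1 `<=` N n) ->
    exists m, forall n, (m <= n)%N -> N n = N m.

Definition right_G0_artinian (C : preadditive) : Prop :=
  forall A : C, gr_artinian (cr_eps A).

Definition gr_simple (C : preadditive) : Prop :=
  (exists x : catring C, x <> 0) /\
  forall I : set (catring C), two_sided_ideal I -> graded I ->
    I = [set 0] \/ I = [set: catring C].

(* Main.v *)
From HB Require Import structures.
From mathcomp Require Import all_boot all_order all_algebra.
From mathcomp Require Import all_classical.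
Require Import Defs.

(** Everything rests on a dictionary between families of sets of morphisms and
    graded subsets of R[C].  A graded subgroup N of R[C] is determined by the
    morphisms f whose copy [cr_in f] in a single degree lies in N, and it
    contains x if and only if it contains each homogeneous component of x
    ([mem_gradedE]).  Products of homogeneous elements are composites of
    morphisms, or zero, so closure of N under multiplication is closure of the
    family of morphisms under composition.

    For a fixed object A, graded right submodules of R[C](eps_A) thus correspond
    to families of subgroups of the groups C(X,A) stable under precomposition,
    that is to subfunctors of C(-,A) ([trace], [span]).  A categorical subobject
    of C(-,A) amounts to a subfunctor as well: a monomorphism of functors is
    injective on each object, because its kernel is itself a functor
    ([monic_injective]), so one subobject factors through another exactly when
    the images are included in one another ([sub_leP]).  Both correspondences
    preserve inclusions, hence transport descending chains and their
    stationarity.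

    In the same way graded two-sided ideals of R[C] correspond to ideals of C,
    with the zero ideal and the whole ring matching the zero ideal and C(-,-). *)

Set Implicit Arguments.
Unset Strict Implicit.
Unset Printing Implicit Defensive.

Import GRing.Theory.
Local Open Scope classical_set_scope.
Local Open Scope ring_scope.

(** * Subfunctors *)

(** A subfunctor is bundled so that the group structure of its values can be
    inferred from it. *)
Record subfunctor (C : preadditive) (F : cofunctor C) := Subfunctor {
  carrier :> forall X : C, set (F X);
  carrier0 : forall X, carrier (0 : F X);
  carrierB : forall X (x y : F X), carrier x -> carrier y -> carrier (x - y);
  carrier_fmap : forall (X Y : C) (f : hom X Y) (x : F Y),
    carrier x -> carrier (fmap F f x) }.

Arguments carrier {C F} s X _.

Section SubfunctorFunctor.
Variables (C : preadditive) (F : cofunctor C) (I : subfunctor F).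

Definition carrier_pred (X : C) : {pred F X} := fun x => x \in I X.
Arguments carrier_pred : clear implicits.

Fact carrier_pred_closed X : zmod_closed (carrier_pred X).
Proof.
split=> [|x y]; rewrite /carrier_pred !unfold_in /=.
  by apply/mem_set; exact: carrier0.
by move=> /set_mem Ix /set_mem Iy; apply/mem_set; exact: carrierB.
Qed.

HB.instance Definition _ X :=
  GRing.isZmodClosed.Build (F X) (carrier_pred X) (carrier_pred_closed X).

Record value (X : C) := Value {
  value_val : F X;
  value_in : value_val \in carrier_pred X }.

HB.instance Definition _ X := [isSub for @value_val X].
HB.instance Definition _ X := [Choice of value X by <:].
HB.instance Definition _ X := [SubChoice_isSubZmodule of value X by <:].

Lemma value_inP X (x : value X) : I X (val x).
Proof. exact: set_mem (value_in x). Qed.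

Definition mk_value X (x : F X) (Ix : I X x) : value X := Value (mem_set Ix).

Definition value_map (X Y : C) (f : hom X Y) (x : value Y) : value X :=
  mk_value (carrier_fmap f (value_inP x)).

Fact value_map_zmod_morphism X Y (f : hom X Y) : zmod_morphism (value_map f).
Proof. by move=> x y; apply: val_inj; rewrite /= raddfB. Qed.

HB.instance Definition _ X Y (f : hom X Y) :=
  GRing.isZmodMorphism.Build (value Y) (value X) (value_map f)
    (value_map_zmod_morphism f).

Fact value_map1 X (x : value X) : value_map (idm X) x = x.
Proof. by apply: val_inj; rewrite /= fmap1. Qed.

Fact value_mapM X Y Z (g : hom Y Z) (f : hom X Y) (x : value Z) :
  value_map (comp g f) x = value_map f (value_map g x).
Proof. by apply: val_inj; rewrite /= fmapM. Qed.

Fact value_mapD X Y (f f' : hom X Y) (x : value Y) :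
  value_map (f + f') x = value_map f x + value_map f' x.
Proof. by apply: val_inj; rewrite /= fmapD. Qed.

Definition sub_cofunctor : cofunctor C :=
  @Cofunctor C value (fun X Y f => value_map f : {additive value Y -> value X})
    value_map1 value_mapM value_mapD.

Definition inclusion : nattrans sub_cofunctor F :=
  @Nattrans C sub_cofunctor F (fun X => \val : {additive value X -> F X})
    (fun X Y f x => erefl).

Lemma inclusion_monic : monic inclusion.
Proof.
move=> H a b ab; apply: nattrans_ext => X x; apply: val_inj.
exact: (congr1 (fun c : nattrans H F => c X x) ab).
Qed.

Definition sub_of : subobj F := Subobj inclusion_monic.
End SubfunctorFunctor.

(** * Subobjects are subfunctors *)

Section Image.
Variables (C : preadditive) (F G : cofunctor C) (i : nattrans G F).

Program Definition image : subfunctor F :=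
  @Subfunctor C F (fun X => range (i X)) _ _ _.
Next Obligation. by move=> X; exists 0; rewrite ?raddf0. Qed.
Next Obligation.
by move=> X _ _ [x _ <-] [y _ <-]; exists (x - y); rewrite ?raddfB.
Qed.
Next Obligation.
by move=> X Y f _ [x _ <-]; exists (fmap G f x); rewrite ?natural.
Qed.

Program Definition kernel : subfunctor G :=
  @Subfunctor C G (fun X => [set x | i X x = 0]) _ _ _.
Next Obligation. by move=> X /=; rewrite raddf0. Qed.
Next Obligation. by move=> X x y /= x0 y0; rewrite raddfB x0 y0 subr0. Qed.
Next Obligation. by move=> X Y f x /= x0; rewrite natural x0 raddf0. Qed.

Program Definition nat_zero : nattrans G F :=
  @Nattrans C G F (fun X => \0 : {additive G X -> F X}) _.
Next Obligation. by move=> X Y f x /=; rewrite raddf0. Qed.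
End Image.

(** The inclusion of the kernel and the zero map become equal after composition
    with the monomorphism, so they are equal and the kernel vanishes. *)
Lemma monic_injective (C : preadditive) (F G : cofunctor C) (i : nattrans G F) :
  monic i -> forall X, injective (i X).
Proof.
move=> mi X x y ixy; pose K := kernel i.
have incl0 : inclusion K = nat_zero G (sub_cofunctor K).
  apply: mi; apply: nattrans_ext => Y k /=.
  by rewrite raddf0; exact: (value_inP k).
have Kxy : K X (x - y) by rewrite /= raddfB ixy subrr.
have := congr1 (fun c : nattrans (sub_cofunctor K) G => c X (mk_value Kxy)) incl0.
exact: subr0_eq.
Qed.

Section Factor.
Variables (C : preadditive) (F : cofunctor C) (i j : subobj F).
Hypothesis ij : forall X, image i X `<=` image j X.

Definition factor_map X (x : sub_dom i X) : sub_dom j X :=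
  s2val (cid2 (ij (imageT (i X) x))).

Lemma factor_mapE X (x : sub_dom i X) : j X (factor_map x) = i X x.
Proof. by rewrite /factor_map; case: cid2. Qed.

Let j_inj X : injective (j X) := @monic_injective _ _ _ _ (sub_monic (s := j)) X.

Fact factor_map_zmod_morphism X : zmod_morphism (@factor_map X).
Proof. by move=> x y; apply: j_inj; rewrite raddfB !factor_mapE raddfB. Qed.

HB.instance Definition _ X :=
  GRing.isZmodMorphism.Build (sub_dom i X) (sub_dom j X) (@factor_map X)
    (@factor_map_zmod_morphism X).

Fact factor_map_natural X Y (f : hom X Y) (x : sub_dom i Y) :
  factor_map (fmap (sub_dom i) f x) = fmap (sub_dom j) f (factor_map x).
Proof. by apply: j_inj; rewrite natural !factor_mapE natural. Qed.

Definition factor : nattrans (sub_dom i) (sub_dom j) :=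
  @Nattrans C (sub_dom i) (sub_dom j)
    (fun X => @factor_map X : {additive sub_dom i X -> sub_dom j X})
    factor_map_natural.
End Factor.

(** Injectivity of j makes the factorization unique on elements, and this
    uniqueness is what makes it additive and natural. *)
Lemma sub_leP (C : preadditive) (F : cofunctor C) (i j : subobj F) :
  sub_le i j <-> forall X, image i X `<=` image j X.
Proof.
split=> [[k ->] X _ [x _ <-]|ij]; first by exists (k X x).
by exists (factor ij); apply: nattrans_ext => X x /=; rewrite factor_mapE.
Qed.

Lemma image_sub_of (C : preadditive) (F : cofunctor C) (I : subfunctor F) X :
  image (sub_of I) X = I X.
Proof.
apply/seteqP; split=> [_ [x _ <-]|x Ix]; first exact: (value_inP x).
by exists (mk_value Ix).
Qed.

(** * Graded subgroups of R[C] *)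

Section GradedSubgroups.
Variable C : preadditive.
Implicit Types (x y : catring C) (A B X Y : C).

Lemma coef_sum (s : seq (catring C)) A B :
  (\sum_(y <- s) y) A B = \sum_(y <- s) y A B.
Proof. by rewrite (big_morph (fun y : catring C => y A B) (id1 := 0) (op1 := +%R)). Qed.

Lemma cr_in_zmod_morphism A B : zmod_morphism (@cr_in C A B).
Proof.
move=> f g; apply: catringP => A' B' /=.
have [[-> ->]|ne] := pselect ((A', B') = (A, B)); first by rewrite !cr_in_id.
by rewrite !cr_in_ne // subr0.
Qed.

HB.instance Definition _ A B :=
  GRing.isZmodMorphism.Build (hom B A) (catring C) (@cr_in C A B)
    (@cr_in_zmod_morphism A B).

Lemma cr_in_inj A B : injective (@cr_in C A B).
Proof.
by move=> f g /(congr1 (fun x : catring C => x A B)); rewrite /= !cr_in_id.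
Qed.

Lemma subgroup_sum (N : set (catring C)) (I : Type) (r : seq I) (P : pred I)
    (f : I -> catring C) :
  subgroup N -> (forall k, P k -> N (f k)) -> N (\sum_(k <- r | P k) f k).
Proof.
move=> [N0 NB] Nf; apply: big_ind => // x y Nx Ny.
by rewrite -[y]opprK; apply: (NB) => //; rewrite -sub0r; exact: NB.
Qed.

(** The component in degree (A,B) of a sum of homogeneous elements of N is the
    sum of those of degree (A,B), hence again in N.  Conversely x is the sum of
    its components. *)
Lemma gradedP (N : set (catring C)) : subgroup N ->
  graded N <-> forall x A B, N x -> N (cr_in (x A B)).
Proof.
move=> sN; split=> [gN x A B|cN].
  rewrite {1}gN => -[s hs ->]; rewrite coef_sum raddf_sum big_seq.
  apply: subgroup_sum => // y /hs[[A' B'] _ [Ny hy]].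
  have [e|ne] := pselect ((A, B) = (A', B')).
    move: hy; rewrite -e homogE => -[f _ fy].
    by move: Ny; rewrite -fy /= cr_in_id.
  by rewrite hy // raddf0; exact: subgroup0.
apply/seteqP; split=> [x Nx|_ [s hs ->]].
  have [t _ e] := catring_decomp x.
  exists [seq cr_in (x p.1 p.2) | p <- t]; last by rewrite big_map.
  move=> _ /mapP[p _ ->]; exists p => //; split; first exact: cN.
  by rewrite [p]surjective_pairing homogE; exists (x p.1 p.2).
by rewrite big_seq; apply: subgroup_sum => // y /hs[g _ []].
Qed.

Lemma mem_gradedE (N : set (catring C)) x : subgroup N -> graded N ->
  N x <-> forall A B, N (cr_in (x A B)).
Proof.
move=> sN gN; split=> [Nx A B|cN]; first exact: (gradedP sN).1.
by have [t _ ->] := catring_decomp x; apply: subgroup_sum.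
Qed.

(** The coefficients of a product are sums of composites, so any subgroup of
    morphisms that contains these composites contains the coefficient. *)
Lemma crM_coef_ind x y A B (P : set (hom B A)) :
  P 0 -> (forall f g, P f -> P g -> P (f - g)) ->
  (forall X, P (comp (x A X) (y X B))) -> P (crM x y A B).
Proof.
move=> P0 PB Pc; rewrite /= /crM_coef; apply: big_ind => // f g Pf Pg.
by rewrite -[g]opprK; apply: (PB) => //; rewrite -sub0r; exact: PB.
Qed.
End GradedSubgroups.

(** * Subfunctors of C(-,A) and graded submodules of R[C](eps_A) *)

Section Dictionary.
Variables (C : preadditive) (A : C).

Section Trace.
Variables (N : set (catring C)) (rN : right_submodule N).

Program Definition trace : subfunctor (representable A) :=
  @Subfunctor C (representable A) (fun X => [set f : hom X A | N (cr_in f)])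
    _ _ _.
Next Obligation.
by move=> X /=; rewrite raddf0; exact: subgroup0 (right_submodule_subgroup rN).
Qed.
Next Obligation.
move=> X f g /= Nf Ng; rewrite raddfB.
exact: (subgroupB (right_submodule_subgroup rN)).
Qed.
Next Obligation.
move=> X Y f g /= Ng; rewrite /precomp -cr_inM; exact: (right_submoduleM rN).
Qed.
End Trace.

(** The trace only sees the degrees with range A; inside R[C](eps_A) all other
    components vanish, so the trace determines the module. *)
Lemma trace_sub (N N' : set (catring C)) (rN : right_submodule N)
    (rN' : right_submodule N') : graded N -> graded N' -> N `<=` cr_eps A ->
  (forall X, trace rN X `<=` trace rN' X) -> N `<=` N'.
Proof.
move=> gN gN' NA sNN' x Nx.
have sN := right_submodule_subgroup rN; have sN' := right_submodule_subgroup rN'.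
apply/mem_gradedE => // B X; have [->|nBA] := pselect (B = A).
  by apply: sNN'; exact: (mem_gradedE _ sN gN).1.
by have /cr_epsP -> // := NA _ Nx; rewrite raddf0; exact: subgroup0.
Qed.

Section Span.
Variable I : subfunctor (representable A).

(** Elements with all components in I.  Belonging to R[C](eps_A) confines x to
    the degrees (A,X), so that the second condition bears on all of x. *)
Definition span : set (catring C) :=
  cr_eps A `&` [set x | forall X, I X (x A X)].

Lemma span_right_submodule : right_submodule span.
Proof.
have [[e0 eB] eM] := cr_eps_right_submodule A.
split; [split|].
- by split=> // X; exact: (carrier0 I).
- move=> x y [ex Ix] [ey Iy]; split; first exact: eB.
  by move=> X; exact: (carrierB (Ix X) (Iy X)).
- move=> x a [ex Ix]; split; first exact: eM.
  move=> X; apply: crM_coef_ind.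
  + exact: (carrier0 I).
  + by move=> f g; exact: (@carrierB _ _ I X f g).
  + by move=> Y; exact: (carrier_fmap (a Y X) (Ix Y)).
Qed.

Lemma cr_in_span X (f : hom X A) : I X f -> span (cr_in f).
Proof.
move=> If; split; first by apply/cr_epsP => B Y nBA /=; rewrite cr_in_ne // => -[].
move=> Y /=; have [->|nYX] := pselect (Y = X); first by rewrite cr_in_id.
by rewrite cr_in_ne; [exact: (carrier0 I) | case].
Qed.

Lemma span_graded : graded span.
Proof.
have rI := span_right_submodule; have sI := right_submodule_subgroup rI.
apply/(gradedP sI) => x B X [/cr_epsP ex Ix].
have [->|nBA] := pselect (B = A); first by apply: cr_in_span; exact: Ix.
by rewrite ex // raddf0; exact: subgroup0.
Qed.

Lemma mem_span_cr_in X (f : hom X A) : span (cr_in f) <-> I X f.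
Proof.
by split=> [[_ /(_ X)] /=|]; [rewrite cr_in_id | exact: cr_in_span].
Qed.
End Span.

Lemma span_le (I J : subfunctor (representable A)) :
  span I `<=` span J <-> forall X, I X `<=` J X.
Proof.
split=> [IJ X f /mem_span_cr_in/IJ/mem_span_cr_in //|IJ x [ex Ix]].
by split=> // X; apply: IJ.
Qed.

Lemma artinian_representable :
  artinian_object (representable A) <-> gr_artinian (cr_eps A).
Proof.
split=> [artA N hN decN|artN S decS].
  have rN n : right_submodule (N n) by have [] := hN n.
  have gN n : graded (N n) by have [_ []] := hN n.
  have NA n : N n `<=` cr_eps A by have [_ []] := hN n.
  have [|m hm] := artA (fun n => sub_of (trace (rN n))).
    by move=> n; apply/sub_leP => X; rewrite !image_sub_of => f; exact: decN.
  exists m => n /hm[/sub_leP nm /sub_leP mn].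
  apply/seteqP; split; [apply: (trace_sub (rN := rN n) (rN' := rN m)) |
    apply: (trace_sub (rN := rN m) (rN' := rN n))] => // X.
    by have := nm X; rewrite !image_sub_of.
  by have := mn X; rewrite !image_sub_of.
have [n|n|m hm] := artN (fun n => span (image (S n))).
- split; first exact: span_right_submodule.
  by split; [exact: span_graded | move=> x []].
- by apply/span_le; exact/sub_leP.
exists m => n /hm e; split; apply/sub_leP/span_le; rewrite e; exact: subset_refl.
Qed.
End Dictionary.

(** * Ideals of C and graded ideals of R[C] *)

Section Ideals.
Variable C : preadditive.

Lemma cat_ideal_trace (I : set (catring C)) : two_sided_ideal I ->
  cat_ideal (fun A B => [set f : hom A B | I (cr_in f)]).
Proof.
move=> [[I0 IB] Ir Il]; split=> [A B|A B f g|A B D g f|A B D g f] /=.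
- by rewrite raddf0.
- by rewrite raddfB; exact: IB.
- by rewrite -cr_inM; exact: Il.
- by rewrite -cr_inM; exact: Ir.
Qed.

Section IdealSpan.
Variables (J : forall A B : C, set (hom A B)) (iJ : cat_ideal J).

Definition ideal_span : set (catring C) := [set x | forall A B, J (x A B)].

Lemma ideal_span_two_sided : two_sided_ideal ideal_span.
Proof.
case: iJ => J0 JB Jl Jr; split; [split|..].
- by move=> A B; exact: J0.
- by move=> x y Jx Jy A B; exact: JB.
- by move=> x a Jx A B; apply: crM_coef_ind => [|f g|X]; [exact: J0|exact: JB|exact: Jr].
- by move=> x a Jx A B; apply: crM_coef_ind => [|f g|X]; [exact: J0|exact: JB|exact: Jl].
Qed.

Lemma mem_ideal_span_cr_in A B (f : hom A B) : ideal_span (cr_in f) <-> J f.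
Proof.
split=> [/(_ B A) /=|Jf B' A' /=]; first by rewrite cr_in_id.
have [[-> ->]|ne] := pselect ((B', A') = (B, A)); first by rewrite cr_in_id.
by rewrite cr_in_ne //; exact: cat_ideal0.
Qed.

Lemma ideal_span_graded : graded ideal_span.
Proof.
apply/(gradedP (two_sided_ideal_subgroup ideal_span_two_sided)) => x A B Jx.
by apply/mem_ideal_span_cr_in; exact: Jx.
Qed.
End IdealSpan.

Lemma catring_neq0 : (exists x : catring C, x <> 0) <->
  exists (A B : C) (f : hom A B), f <> 0.
Proof.
split=> [[x x0]|[A [B [f f0]]]].
  apply: contrapT => hom0; apply: x0; apply: catringP => A B.
  by apply: contrapT => xAB; apply: hom0; exists B, A, (x A B).
by exists (cr_in f); rewrite -(raddf0 (@cr_in C B A)) => /cr_in_inj.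
Qed.

Lemma simple_gr_simple : simple_category C <-> gr_simple C.
Proof.
split=> -[/catring_neq0 n0 simp]; split=> //.
  move=> I iI gI; have sI := two_sided_ideal_subgroup iI.
  have simpI := simp _ (cat_ideal_trace iI).
  have [nzI|zI] := pselect (exists (A B : C) (f : hom A B), I (cr_in f) /\ f <> 0).
    right; apply/seteqP; split=> // x _.
    by apply/(mem_gradedE x sI gI) => A B; exact: simpI.
  left; apply/seteqP; split=> [x Ix|_ ->]; last exact: subgroup0.
  apply: catringP => A B; apply: contrapT => xAB; apply: zI.
  by exists B, A, (x A B); split=> //; exact: (gradedP sI).1.
move=> J iJ [A [B [f [Jf f0]]]].
have spanf : ideal_span J (cr_in f) by exact/mem_ideal_span_cr_in.
have [e|e] := simp _ (ideal_span_two_sided iJ) (ideal_span_graded iJ).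
  by move: spanf; rewrite e /= -(raddf0 (@cr_in C B A)) => /cr_in_inj.
by move=> A' B' g; apply/(mem_ideal_span_cr_in iJ); rewrite e.
Qed.
End Ideals.

Theorem proposition8p7 (C : preadditive) :
  (forall A : C, artinian_object (representable A) <-> gr_artinian (cr_eps A)) /\
  (right_artinian_category C <-> right_G0_artinian C) /\
  (simple_category C <-> gr_simple C).
Proof.
split; first exact: artinian_representable.
split; last exact: simple_gr_simple.
by split=> art A; apply/artinian_representable.
Qed.
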